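(* Let $V$ be a vertex algebra, let $g$ be an automorphism of $V$ with period $T$, let $W$ be a $g$-twisted $V$-module, and let $\{E_n^T(W)\}_{n\in\mathbb{Z}}$ be the associated decreasing sequence. Then for any $n\ge 2$, $$C_n^T(W)\subset E^T_{(n-2)T+1}(W),$$ $$E_m^T(W)\subset C_n^T(W)\quad\text{whenever } m\ge\max\{1,(n-2)T(T+1)2^{n-3}\}.$$ Furthermore, $$\bigcap_{n\ge0}E_n^T(W)=\bigcap_{n\ge2}C_{n+2}^T(W).$$
   Context: Vertex algebras are over $\mathbb{C}$; a vertex algebra $V$ has vertex operators $Y(v,x)=\sum_{n\in\mathbb{Z}}v_nx^{-n-1}$ ($v_n\in\mathrm{End}\,V$) and vacuum $\mathbf{1}$. An automorphism of $V$ is a linear isomorphism $g$ with $gY(v,x)g^{-1}=Y(g(v),x)$ for all $v\in V$; it has period $T$ ($T$ a positive integer) if $g^T=1$. Then $V=\bigoplus_{r=0}^{T-1}V^r$ with $V^r=\{v\in V: g(v)=e^{2\pi i r/T}v\}$. A $g$-twisted $V$-module is a vector space $W$ with a linear map $Y_W(\cdot,x):V\to(\mathrm{End}\,W)[[x^{1/T},x^{-1/T}]]$, $Y_W(v,x)=\sum_{n\in\frac1T\mathbb{Z}}v_nx^{-n-1}$, such that for $u\in V^r$ ($0\le r\le T-1$), $v\in V$, $w\in W$: $Y_W(u,x)=\sum_{n\in\frac rT+\mathbb{Z}}u_nx^{-n-1}$; $u_nw=0$ for $n\in\frac rT+\mathbb{Z}$ sufficiently large; $Y_W(\mathbf{1},x)=\mathrm{Id}_W$;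 and $$x_0^{-1}\delta\left(\tfrac{x_1-x_2}{x_0}\right)Y_W(u,x_1)Y_W(v,x_2)w-x_0^{-1}\delta\left(\tfrac{x_2-x_1}{-x_0}\right)Y_W(v,x_2)Y_W(u,x_1)w=x_2^{-1}\left(\tfrac{x_1-x_0}{x_2}\right)^{-\frac rT}\delta\left(\tfrac{x_1-x_0}{x_2}\right)Y_W(Y(u,x_0)v,x_2)w,$$ where $\delta(x)=\sum_{n\in\mathbb{Z}}x^n$ and binomials are expanded in nonnegative integral powers of the second variable. $E_n^T(W)$ ($n\in\mathbb{Z}$) is the linear span of all $u^{(1)}_{-1-k_1+\frac{r_1}{T}}\cdots u^{(s)}_{-1-k_s+\frac{r_s}{T}}w$ with $s\ge1$, $u^{(i)}\in V^{r_i}$, $0\le r_i\le T-1$, $w\in W$, $k_i\ge0$, $k_1+\cdots+k_s-\frac{r_1+\cdots+r_s}{T}\ge\frac nT$. For $n\ge2$, $C_n^T(W)=\mathrm{span}\{u_{-n+\frac pT}w: u\in V^p,\ w\in W,\ p=0,1,\dots,T-1\}$. *)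

(* Defs.v *)
From HB Require Import structures.
From mathcomp Require Import all_boot all_order all_algebra.
From mathcomp Require Import complex.
From mathcomp Require Import all_classical all_reals all_analysis.

Set Implicit Arguments.
Unset Strict Implicit.
Unset Printing Implicit Defensive.
Import Order.TTheory GRing.Theory Num.Theory.
Local Open Scope classical_set_scope.
Local Open Scope ring_scope.

Section LinearSpan.
Variables (K : pzRingType) (M : lmodType K).

Definition lspan (S : set M) : set M :=
  [set x | exists (n : nat) (c : 'I_n -> K) (s : 'I_n -> M),
     (forall i, S (s i)) /\ x = \sum_(i < n) c i *: s i].

End LinearSpan.

Section FormalCalculus.
Variables (K : numFieldType) (M : lmodType K).

(* A formal series in three variables with rational exponents is the function
   sending a triple of exponents to its coefficient. *)
Definition series3 := rat -> rat -> rat -> M.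

Definition gbinom (a : rat) (j : nat) : rat :=
  (\prod_(i < j) (a - i%:R)) / j`!%:R.

(* The product with F(y, z1, z2) of
     y^-1 ((z1 - z2) / y)^rho delta((z1 - z2) / (eps y))
       = sum_{n in Z, j >= 0}
           eps^-n (-1)^j binom(n + rho, j) y^(-1-n-rho) z1^(n+rho-j) z2^j,
   where eps = 1 or -1.  Multiplying by a monomial shifts the exponents of F.
   The sum is over the pairs (n, j) with a nonzero term; it would be 0 by
   convention if there were infinitely many, which truncation excludes for the
   F below. *)
Definition delta_mul (rho eps : rat) (F : series3) : series3 :=
  fun a b c => \sum_(t \in [set: int * nat])
    ratr (eps ^ (- t.1) * (-1) ^+ t.2 * gbinom (t.1%:~R + rho) t.2) *:
      F (a - (- 1 - t.1%:~R - rho)) (b - (t.1%:~R + rho - t.2%:R))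
        (c - t.2%:R).

End FormalCalculus.

(* Modes are indexed by rationals here: [Y u n] is the coefficient of x^(-n-1)
   in Y(u, x), so the coefficient of x^e is [Y u (- e - 1)].  With
   rho = - r / T this is the twisted Jacobi identity applied to w, compared at
   x0^a x1^b x2^c; with rho = 0 it is the untwisted one. *)
Definition jacobi (K : numFieldType) (V M : lmodType K)
    (YV : V -> rat -> V -> V) (Y : V -> rat -> M -> M)
    (rho : rat) (u v : V) (w : M) : Prop :=
  forall a b c : rat,
    delta_mul 0 1
      (fun e0 e1 e2 => if e0 == 0 then Y u (- e1 - 1) (Y v (- e2 - 1) w) else 0)
      a b c
    - delta_mul 0 (-1)
      (fun e0 e2 e1 => if e0 == 0 then Y v (- e2 - 1) (Y u (- e1 - 1) w) else 0)
      a c b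
    = delta_mul rho 1
      (fun e2 e1 e0 => if e1 == 0 then Y (YV u (- e0 - 1) v) (- e2 - 1) w else 0)
      c b a.

Section VertexAlgebra.
Variable R : realType.

Definition rat_modes (V : lmodType R[i]) (Y : V -> int -> V -> V) :
    V -> rat -> V -> V :=
  fun v n u => if n \is a Num.int then Y v (numq n) u else 0.

Record vertexAlgebra := VertexAlgebra {
  va_sort :> lmodType R[i];
  va_mode : va_sort -> int -> va_sort -> va_sort;
  va_vac : va_sort;
  va_linearl : forall n u, linear (fun v => va_mode v n u);
  va_linearr : forall v n, linear (va_mode v n);
  va_truncation : forall u v, exists N : int,
    forall n : int, N <= n -> va_mode u n v = 0;
  va_vacuum : forall n v, va_mode va_vac n v = if n == -1 then v else 0;
  va_creation : forall v, va_mode v (-1) va_vac = v /\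
    (forall n : int, 0 <= n -> va_mode v n va_vac = 0);
  va_jacobi : forall u v w,
    jacobi (rat_modes va_mode) (rat_modes va_mode) 0 u v w }.

Definition va_automorphism (V : vertexAlgebra) (g : V -> V) : Prop :=
  [/\ linear g, bijective g
    & forall v n u, g (va_mode v n u) = va_mode (g v) n (g u)].

Definition has_period (V : Type) (g : V -> V) (T : nat) : Prop :=
  (0 < T)%N /\ iter T g =1 id.

Definition root_of_unity (r T : nat) : R[i] :=
  let theta : R := 2 * pi * r%:R / T%:R in Complex (cos theta) (sin theta).

Definition grade (V : vertexAlgebra) (g : V -> V) (T r : nat) : set V :=
  [set v | g v = root_of_unity r T *: v].

Record twistedModule (V : vertexAlgebra) (g : V -> V) (T : nat) :=
    TwistedModule {
  tw_sort :> lmodType R[i];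
  tw_mode : V -> rat -> tw_sort -> tw_sort;
  tw_linearl : forall n w, linear (fun v => tw_mode v n w);
  tw_linearr : forall v n, linear (tw_mode v n);
  tw_exponents : forall v n w,
    T%:R * n \isn't a Num.int -> tw_mode v n w = 0;
  tw_grade : forall (r : 'I_T) u n w, grade g T r u ->
    n - r%:R / T%:R \isn't a Num.int -> tw_mode u n w = 0;
  tw_truncation : forall (r : 'I_T) u w, grade g T r u ->
    exists N : rat, forall n : rat,
      n - r%:R / T%:R \is a Num.int -> N <= n -> tw_mode u n w = 0;
  tw_vacuum : forall n w,
    tw_mode (va_vac V) n w = if n == -1 then w else 0;
  tw_jacobi : forall (r : 'I_T) u v w, grade g T r u ->
    jacobi (rat_modes (@va_mode V)) tw_mode (- (r%:R / T%:R)) u v w }.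

Section Filtrations.
Variables (V : vertexAlgebra) (g : V -> V) (T : nat) (W : twistedModule g T).

(* The factor (u, k, r) stands for the operator u_{-1-k+r/T}. *)
Definition factor : Type := (V * nat * 'I_T)%type.

Definition apply_factor (f : factor) (w : W) : W :=
  let: (u, k, r) := f in tw_mode u (- 1 - k%:R + r%:R / T%:R) w.

Definition apply_factors (l : seq factor) (w : W) : W := foldr apply_factor w l.

Definition factors_weight (l : seq factor) : rat :=
  \sum_(f <- l) f.1.2%:R - (\sum_(f <- l) f.2%:R) / T%:R.

Definition E_space (n : int) : set W :=
  lspan [set x | exists (l : seq factor) (w : W),
    [/\ (1 <= size l)%N, forall f, f \in l -> grade g T f.2 f.1.1,
        n%:~R / T%:R <= factors_weight l & x = apply_factors l w]].

Definition C_space (n : nat) : set W :=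
  lspan [set x | exists (p : 'I_T) (u : V) (w : W),
    grade g T p u /\ x = tw_mode u (- n%:R + p%:R / T%:R) w].

End Filtrations.

End VertexAlgebra.

Arguments apply_factor {R V g T} W f w.
Arguments apply_factors {R V g T} W l w.
Arguments E_space {R V g T} W n _.
Arguments C_space {R V g T} W n _.

(* Main.v *)
Require Import Defs.
From mathcomp Require Import all_boot all_order all_algebra.
From mathcomp Require Import complex.
From mathcomp Require Import all_classical all_reals all_analysis.
From mathcomp Require Import ring lra zify.

Set Implicit Arguments.
Unset Strict Implicit.
Unset Printing Implicit Defensive.
Import Order.TTheory GRing.Theory Num.Theory.
Local Open Scope classical_set_scope.
Local Open Scope ring_scope.

(* Write u(k, p) for u_(-1 - k + p/T) with u in V^p, k >= 0; then C_(k + 1) is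
   spanned by the images of the u(k, p), and the derivation u -> u_(-2) 1 makes
   C_n decreasing. By the commutator formula, C_n is stable under all u(k, p).
   So a product with a factor k >= n - 1 lands in C_n, and in a product of large
   weight without such a factor, many factors have k >= 1. It is enough that
   (T + 1) 2^(n - 3) of them force the product into C_n, for n >= 3.

   The l = -1 Borcherds identity gives
     u(j, r) v(j, s) w = (u_(-1) v)(2j - d, q) w  modulo C_(j + 2)
   for j >= 1, where r + s = q + d T. For j >= 2 the right side is in C_(j + 2).
   Given enough factors for C_(j + 1), twice as many thus give C_(j + 2): the
   inner half produces elements v(j, s) w', v(j, s) can be moved past the outer
   half, and then that half produces another operator u(j, r).
   For j = 1 the right side is in C_3 (d = 0), or else (d = 1) it is again a
   u(1, q), with T - q = (T - r) + (T - s); as T - q <= T, T + 1 factors with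
   k >= 1 give C_3. *)

(** * Binomial coefficients with a rational upper argument *)

Section Binomials.

Lemma gbinom0 a : gbinom a 0 = 1.
Proof. by rewrite /gbinom big_ord0 fact0 divr1. Qed.

Lemma gbinom1 a : gbinom a 1 = a.
Proof. by rewrite /gbinom big_ord1 subr0 divr1. Qed.

Lemma gbinom0n j : (0 < j)%N -> gbinom 0 j = 0.
Proof.
by case: j => // j _; rewrite /gbinom big_ord_recl subrr !mul0r.
Qed.

(** Upper negation, by reversing the product. It turns the binomials of the twisted delta function
    into the [gbinom m j] of the Borcherds identity. *)
Lemma gbinom_neg m j : (-1) ^+ j * gbinom (j%:R - 1 - m) j = gbinom m j.
Proof.
rewrite /gbinom mulrA; congr (_ / _).
rewrite (reindex_inj rev_ord_inj) /=.
rewrite -[X in _ ^+ X](card_ord j) -prodr_const -big_split /=.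
apply: eq_bigr => i _; rewrite natrB ?ltn_ord // -natr1; ring.
Qed.

Lemma gbinom_diag j : gbinom j%:R j = 1.
Proof.
rewrite /gbinom; suff -> : \prod_(i < j) (j%:R - i%:R) = j`!%:R :> rat.
  by rewrite divff // pnatr_eq0 -lt0n fact_gt0.
elim: j => [|j IHj]; first by rewrite big_ord0.
rewrite big_ord_recl subr0 factS natrM -IHj; congr (_ * _).
by apply: eq_bigr => i _; rewrite /= /bump /= !add1n -!natr1; ring.
Qed.

Lemma gbinomN1 j : (-1) ^+ j * gbinom (- 1) j = 1.
Proof.
have := gbinom_neg j%:R j; rewrite gbinom_diag.
by rewrite (_ : j%:R - 1 - j%:R = - 1) //; ring.
Qed.

End Binomials.

(** * Coefficients of products with delta functions *)

Section DeltaMul.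
Variables (K : numFieldType) (M : lmodType K).

(** In each term of the Jacobi identity one exponent must be 0, which makes [n] a function [nu] of
    [j], and truncation bounds [j]. The sum over pairs thus becomes an ordinary finite sum. *)
Lemma delta_mulE rho eps (F : series3 M) (a b c : rat)
    (nu : nat -> int) (m : nat) :
  (forall n j,
     F (a - (- 1 - n%:~R - rho)) (b - (n%:~R + rho - j%:R)) (c - j%:R) != 0 ->
     n = nu j /\ (j < m)%N) ->
  delta_mul rho eps F a b c = \sum_(j < m)
    ratr (eps ^ (- nu j) * (-1) ^+ j * gbinom ((nu j)%:~R + rho) j) *:
      F (a - (- 1 - (nu j)%:~R - rho)) (b - ((nu j)%:~R + rho - j%:R))
        (c - j%:R).
Proof.
move=> Fsupp; rewrite /delta_mul.
set G := (fun t : int * nat => _).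
rewrite -(@fsbig_widen _ _ 0 +%R ((fun j => (nu j, j)) @` `I_m)) //.
  rewrite fsbig_image; last first.
    by move=> x y _ _ [_ ->].
  by rewrite -(fsbig_ord _ _
    (fun j => ratr _ *: F (_ - (- 1 - (nu j)%:~R - rho)) _ _)).
move=> [n j] [_ /= nim]; rewrite /G /=.
case: (eqVneq
  (F (a - (- 1 - n%:~R - rho)) (b - (n%:~R + rho - j%:R)) (c - j%:R)) 0).
  by move=> ->; rewrite scaler0.
by move=> /Fsupp [nE jm]; case: nim; exists j; rewrite ?nE.
Qed.

End DeltaMul.

Section LinearFunctions.
Variables (K : pzRingType) (M N : lmodType K) (f : M -> N).
Hypothesis lin_f : linear f.

Lemma linear_at0 : f 0 = 0.
Proof. by have := lin_f (-1) 0 0; rewrite scaler0 addr0 scaleN1r addNr. Qed.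

Lemma linear_atZ a x : f (a *: x) = a *: f x.
Proof. by rewrite -[a *: x]addr0 lin_f linear_at0 addr0. Qed.

End LinearFunctions.

Lemma rat_arch (x y : rat) :
  exists k : nat, forall j : nat, (k <= j)%N -> x <= y + j%:R.
Proof.
exists (Num.truncn (x - y)).+1 => j kj.
rewrite -lerBlDl; apply/ltW/(lt_le_trans (truncnS_gt _)).
by rewrite ler_nat.
Qed.

(** * The twisted Borcherds identity for modes *)

Section BorcherdsIdentity.
Variables (R : realType) (V : vertexAlgebra R) (g : V -> V) (T : nat).
Variable W : twistedModule g T.

Local Notation mode := (@tw_mode R V g T W).

Lemma mode_truncation (r : 'I_T) (u : V) (w : W) : grade g T r u ->
  exists N : rat, forall n : rat, N <= n -> mode u n w = 0.
Proof.
move=> gu; have [N truncN] := tw_truncation w gu; exists N => n Nn.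
case: (boolP (n - r%:R / T%:R \is a Num.int)) => nr; first exact: truncN.
exact: tw_grade nr.
Qed.

(** Compare the coefficients of x0^(-1-l) x1^(-m-1) x2^(-n-1) in the Jacobi identity. All terms with
    index at least [M0] vanish; [M] is left free so that later proofs can split off the terms they
    need. *)
Lemma borcherds_identity (r s : 'I_T) (u v : V) (l : int) (m n : rat) (w : W) :
  grade g T r u -> grade g T s v -> m - r%:R / T%:R \is a Num.int ->
  exists M0 : nat, forall M : nat, (M0 <= M)%N ->
    \sum_(j < M) ratr (gbinom m j) *:
      mode (va_mode u (l + j%:Z) v) (m + n - j%:R) w
    = \sum_(j < M) ratr ((-1) ^+ j * gbinom l%:~R j) *:
        mode u (m + l%:~R - j%:R) (mode v (n + j%:R) w)
    - \sum_(j < M) ratr ((-1) ^ (- l) * (-1) ^+ j * gbinom l%:~R j) *: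
        mode v (n + l%:~R - j%:R) (mode u (m + j%:R) w).
Proof.
move=> gu gv mr.
have [Nu truncu] := mode_truncation w gu.
have [Nv truncv] := mode_truncation w gv.
have [Nuv truncuv] := va_truncation u v.
have [M1 M1P] := rat_arch Nv n.
have [M2 M2P] := rat_arch Nu m.
have [M3 M3P] := rat_arch Nuv%:~R l%:~R.
exists (maxn M1 (maxn M2 M3)) => M.
rewrite !geq_max => /and3P[M1M M2M M3M].
have mode0 x y : mode x y 0 = 0 by apply/linear_at0/tw_linearr.
have := tw_jacobi v w gu (- 1 - l%:~R) (- m - 1) (- n - 1).
rewrite (@delta_mulE _ _ _ _ _ _ _ _ (fun=> l) M); last first.
  move=> k j /=; case: ifP => [/eqP kl|]; last by rewrite eqxx.
  move=> nz; split.
    by apply/eqP; rewrite -(eqr_int rat); apply/eqP; move: kl; lra.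
  rewrite ltnNge; apply: contraNN nz => Mj.
  rewrite (_ : - (- n - 1 - j%:R) - 1 = n + j%:R); last by ring.
  by rewrite truncv ?mode0 // M1P // (leq_trans M1M).
rewrite (@delta_mulE _ _ _ _ _ _ _ _ (fun=> l) M); last first.
  move=> k j /=; case: ifP => [/eqP kl|]; last by rewrite eqxx.
  move=> nz; split.
    by apply/eqP; rewrite -(eqr_int rat); apply/eqP; move: kl; lra.
  rewrite ltnNge; apply: contraNN nz => Mj.
  rewrite (_ : - (- m - 1 - j%:R) - 1 = m + j%:R); last by ring.
  by rewrite truncu ?mode0 // M2P // (leq_trans M2M).
(* On the iterate side the exponent of x1 in the series must be 0, which forces the summation index
   to be [z + j]; the hypothesis on [m] makes [z] an integer. *)
have [z zE] : exists z : int, - m - 1 + r%:R / T%:R = z%:~R.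
  apply/intrP; rewrite (_ : _ + _ = - (m - r%:R / T%:R) - 1); last by ring.
  by rewrite rpredB ?rpredN.
rewrite (@delta_mulE _ _ _ _ _ _ _ _ (fun j => z + j%:Z) M); last first.
  move=> k j /=; case: ifP => [/eqP kz|]; last by rewrite eqxx.
  move=> nz; split.
    apply/eqP; rewrite -(eqr_int rat) intrD; apply/eqP; move: kz zE.
    by rewrite pmulrn; lra.
  rewrite ltnNge; apply: contraNN nz => Mj.
  rewrite (_ : - (- 1 - l%:~R - j%:R) - 1 = (l + j%:Z)%:~R); last first.
    by rewrite intrD; ring.
  rewrite /rat_modes intr_int numq_int truncuv.
    by apply/eqP; exact: (linear_at0 (tw_linearl _ _)).
  rewrite -(ler_int rat) intrD; apply: M3P; exact: leq_trans M3M Mj.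
move=> jac.
transitivity (\sum_(j < M)
  ratr (1 ^ (- (z + j%:Z)) * (-1) ^+ j *
     gbinom ((z + j%:Z)%:~R + - (r%:R / T%:R)) j) *:
  mode (rat_modes (@va_mode _ V) u (- (- 1 - l%:~R - j%:R) - 1) v)
    (- (- n - 1 - (-1 - (z + j%:Z)%:~R - - (r%:R / T%:R))) - 1) w).
  apply: eq_bigr => j _.
  rewrite (_ : - (- 1 - l%:~R - j%:R) - 1 = (l + j%:Z)%:~R); last first.
    by rewrite intrD; ring.
  rewrite /rat_modes intr_int numq_int exp1rz mul1r.
  have zj : (z + j%:Z)%:~R - r%:R / T%:R = j%:R - 1 - m :> rat.
    by rewrite intrD -zE; ring.
  rewrite zj gbinom_neg; congr (_ *: mode _ _ _).
  by rewrite opprK; move: zj; lra.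
transitivity (\sum_(j < M)
  ratr (1 ^ (- l) * (-1) ^+ j * gbinom (l%:~R + 0) j) *:
   mode u (- (- m - 1 - (l%:~R + 0 - j%:R)) - 1)
     (mode v (- (- n - 1 - j%:R) - 1) w) -
 \sum_(j < M)
  ratr ((-1) ^ (- l) * (-1) ^+ j * gbinom (l%:~R + 0) j) *:
   mode v (- (- n - 1 - (l%:~R + 0 - j%:R)) - 1)
     (mode u (- (- m - 1 - j%:R) - 1) w)); last first.
  congr (_ - _); apply: eq_bigr => j _; rewrite ?exp1rz ?mul1r !addr0;
  by congr (_ *: mode _ _ (mode _ _ _)); ring.
have l0 : - 1 - l%:~R - (- 1 - l%:~R - 0) = 0 :> rat by ring.
symmetry; move: jac => /=; rewrite !l0 eqxx => ->.
apply: eq_bigr => j _; rewrite ifT //.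
by apply/eqP; rewrite intrD -zE; ring.
Qed.

End BorcherdsIdentity.

(** * Submodules and linear spans *)

Section Submodules.
Variables (K : pzRingType) (M : lmodType K).

Definition submodule (P : set M) : Prop :=
  P 0 /\ forall a x y, P x -> P y -> P (a *: x + y).

Lemma submoduleZ P a x : submodule P -> P x -> P (a *: x).
Proof. by move=> [P0 PD] Px; rewrite -[_ *: _]addr0; exact: PD. Qed.

Lemma submoduleD P x y : submodule P -> P x -> P y -> P (x + y).
Proof. by move=> [_ PD] Px Py; rewrite -[x]scale1r; exact: PD. Qed.

Lemma submoduleB P x y : submodule P -> P x -> P y -> P (x - y).
Proof.
move=> Psub Px Py; apply: submoduleD => //.
by rewrite -scaleN1r; exact: submoduleZ.
Qed.

Lemma submodule_sum P (I : Type) (r : seq I) (Q : pred I) (F : I -> M) :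
  submodule P -> (forall i, Q i -> P (F i)) -> P (\sum_(i <- r | Q i) F i).
Proof.
move=> Psub PF; elim/big_ind: _ => //; first by case: Psub.
by move=> x y; exact: submoduleD.
Qed.

Lemma lspan_submodule (S : set M) : submodule (lspan S).
Proof.
split.
  by exists 0%N, (fun=> 0), (fun=> 0); split=> [[]|] //; rewrite big_ord0.
move=> a x y [m [c [s [Ss ->]]]] [n [d [t [St ->]]]].
exists (m + n)%N,
  (fun i => match fintype.split i with inl j => a * c j | inr j => d j end),
  (fun i => match fintype.split i with inl j => s j | inr j => t j end).
split=> [i|]; first by case: fintype.split.
rewrite big_split_ord /= scaler_sumr; congr (_ + _); apply: eq_bigr => i _.
  by rewrite (unsplitK (inl i)) scalerA.
by rewrite (unsplitK (inr i)).
Qed.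

Lemma sub_lspan (S : set M) : S `<=` lspan S.
Proof.
move=> x Sx; exists 1%N, (fun=> 1), (fun=> x); split=> //.
by rewrite big_ord1 scale1r.
Qed.

Lemma lspan_min (S P : set M) : submodule P -> S `<=` P -> lspan S `<=` P.
Proof.
move=> Psub SP x [n [c [s [Ss ->]]]]; apply: submodule_sum => // i _.
by apply: submoduleZ => //; exact: SP.
Qed.

End Submodules.

Lemma submodule_preimage (K : pzRingType) (M N : lmodType K) (f : M -> N)
    (P : set N) : linear f -> submodule P -> submodule (f @^-1` P).
Proof.
move=> lin_f [P0 PD]; split; first by rewrite /= linear_at0.
by move=> a x y Px Py /=; rewrite lin_f; exact: PD.
Qed.

(** * The grading by eigenspaces of the automorphism *)

Section Grading.
Variable R : realType.

Lemma root_of_unity0 T : Defs.root_of_unity R 0 T = 1.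
Proof. by rewrite /Defs.root_of_unity /= mulr0n mulr0 mul0r cos0 sin0. Qed.

Lemma root_of_unityD T r s :
  Defs.root_of_unity R r T * Defs.root_of_unity R s T
  = Defs.root_of_unity R (r + s) T.
Proof.
rewrite /Defs.root_of_unity /= natrD; move: (2 * pi) => tau.
rewrite mulrDr mulrDl cosD sinD.
by rewrite [LHS]/GRing.mul /= addrC [sin _ * _ + _]addrC.
Qed.

Lemma root_of_unityDT T r : (0 < T)%N ->
  Defs.root_of_unity R (r + T) T = Defs.root_of_unity R r T.
Proof.
move=> T0; rewrite /Defs.root_of_unity /=.
have -> : 2 * pi * (r + T)%:R / T%:R = 2 * pi * r%:R / T%:R + pi *+ 2 :> R.
  by rewrite natrD; field; rewrite pnatr_eq0 -lt0n.
by rewrite cosD2pi sinD2pi.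
Qed.

Definition sum_degree T (r s : 'I_T) : 'I_T :=
  Ordinal (ltn_pmod (r + s) (leq_ltn_trans (leq0n r) (ltn_ord r))).

(** This is the [d] in r + s = q + d T. If [k] is called the depth of u(k, p), then a mode of u_i v
    that arises from u(k, r) and v(j, s) loses depth [d]. *)
Definition carry T (r s : 'I_T) : nat := (T <= r + s)%N.

Lemma sum_degreeE T (r s : 'I_T) : (sum_degree r s + carry r s * T = r + s)%N.
Proof.
rewrite /carry /=; case: leqP => rs; last by rewrite mul0n addn0 modn_small.
rewrite mul1n -{1}(subnK rs) modnDr modn_small ?subnK //.
by have := ltn_ord r; have := ltn_ord s; lia.
Qed.

Lemma carry_le1 T (r s : 'I_T) : (carry r s <= 1)%N.
Proof. by rewrite /carry; case: (T <= _)%N. Qed.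

Lemma root_of_unity_sum_degree T (r s : 'I_T) :
  Defs.root_of_unity R r T * Defs.root_of_unity R s T
  = Defs.root_of_unity R (sum_degree r s) T.
Proof.
rewrite root_of_unityD -sum_degreeE /carry.
case: leqP => _; rewrite ?mul0n ?addn0 // mul1n root_of_unityDT //.
exact: leq_ltn_trans (leq0n r) (ltn_ord r).
Qed.

Variables (V : vertexAlgebra R) (g : V -> V).
Hypothesis hg : va_automorphism g.

(** By creation, the image of the vacuum is its own (-1)-mode applied to the vacuum. Writing the
    latter as [g] of some [x], this is [g] of the (-1)-mode of the vacuum on [x], hence [g x]. *)
Lemma automorphism_vacuum : g (va_vac V) = va_vac V.
Proof.
case: hg => _ [h _ gK] gY.
rewrite -[LHS](va_creation (g (va_vac V))).1.
rewrite -[va_vac V in X in va_mode _ _ X]gK.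
by rewrite -gY va_vacuum eqxx gK.
Qed.

Lemma grade_vacuum T : grade g T 0 (va_vac V).
Proof. by rewrite /grade /= automorphism_vacuum root_of_unity0 scale1r. Qed.

Lemma grade_mode T (r s : 'I_T) u v n :
  grade g T r u -> grade g T s v -> grade g T (sum_degree r s) (va_mode u n v).
Proof.
case: hg => _ _ gY gu gv; rewrite /grade /= gY gu gv.
rewrite (linear_atZ (va_linearr _ _)) (linear_atZ (va_linearl _ _)).
by rewrite scalerA mulrC root_of_unity_sum_degree.
Qed.

Lemma grade_derivative T (r : 'I_T) u :
  grade g T r u -> grade g T r (va_mode u (-2) (va_vac V)).
Proof.
case: hg => _ _ gY gu; rewrite /grade /= gY automorphism_vacuum gu.
by rewrite (linear_atZ (va_linearl _ _)).
Qed.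

End Grading.

(** * Operators of given depth acting on the spaces [C_n] *)

Section TwistedModes.
Variables (R : realType) (V : vertexAlgebra R) (g : V -> V) (T : nat).
Hypotheses (hg : va_automorphism g) (T_gt0 : (0 < T)%N).
Variable W : twistedModule g T.

Local Notation mode := (@tw_mode R V g T W).
Local Notation fmode u k p := (apply_factor W (u, (k%N : nat), p)).

Lemma T_neq0 : T%:R != 0 :> rat.
Proof. by rewrite pnatr_eq0 -lt0n. Qed.

Lemma fmode_linear u k (p : 'I_T) : linear (fmode u k p).
Proof. exact: tw_linearr. Qed.

Lemma fmode_exponent k (p : 'I_T) :
  - 1 - k%:R + p%:R / T%:R - p%:R / T%:R \is a @Num.int rat.
Proof. by rewrite addrK rpredB ?rpredN ?rpred1 ?natr_int. Qed.

Lemma sum_degree_exponent (r s : 'I_T) :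
  r%:R / T%:R + s%:R / T%:R
  = (sum_degree r s)%:R / T%:R + (carry r s)%:R :> rat.
Proof.
rewrite -mulrDl -natrD -(sum_degreeE r s) natrD natrM mulrDl mulfK //.
exact: T_neq0.
Qed.

(** Take [v] the vacuum, l = -2 and n = 0 in the Borcherds identity. On the right, the vacuum has
    only modes [i] and [-2 - i] with i >= 0, never -1, so everything vanishes; on the left, creation
    leaves the terms 0 and 1. *)
Lemma mode_derivative (p : 'I_T) u m w : grade g T p u ->
  m - p%:R / T%:R \is a Num.int ->
  mode (va_mode u (-2) (va_vac V)) m w = - ratr m *: mode u (m - 1) w.
Proof.
move=> gu mp.
have gv : grade g T (Ordinal T_gt0) (va_vac V) by exact: grade_vacuum.
have [M0 /(_ (M0 + 2)%N (leq_addr _ _))] :=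
  borcherds_identity (-2) 0 w gu gv mp.
have mode0 x y : mode x y 0 = 0 by apply/linear_at0/tw_linearr.
rewrite [X in _ = X - _]big1 => [|i _]; last first.
  rewrite tw_vacuum ifF ?mode0 ?scaler0 //; apply: gt_eqF.
  by have : 0 <= (i : nat)%:R :> rat by []; lra.
rewrite [X in _ = _ - X]big1 => [|i _]; last first.
  rewrite tw_vacuum ifF ?scaler0 //; apply: lt_eqF.
  by have : 0 <= (i : nat)%:R :> rat by []; lra.
rewrite addn2 !big_ord_recl big1 => [|i _]; last first.
  rewrite /= /bump /= !add1n (va_creation u).2; last by lia.
  by rewrite (linear_at0 (tw_linearl _ _)) scaler0.
rewrite /bump /= gbinom0 gbinom1 rmorph1 scale1r subrr !addr0.
rewrite (_ : -2 + (bump 0 0)%:Z = -1) // (va_creation u).1.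
by move/eqP; rewrite addr_eq0 scaleNr => /eqP.
Qed.

Lemma C_submodule n : submodule (C_space W n).
Proof. exact: lspan_submodule. Qed.

(** Passing to the derivative of [u] lowers the depth by one and keeps the degree. The scalar [m]
    can be inverted because p < T makes it negative. *)
Lemma C_fmode j k (p : 'I_T) u w : grade g T p u -> (j <= k)%N ->
  C_space W j.+1 (fmode u k p w).
Proof.
move=> gu /subnKC <-; elim: (k - j)%N u gu => {k} [|e IHe] u gu.
  apply: sub_lspan; exists p, u, w; split=> //.
  by rewrite /apply_factor addn0 -natr1; congr (tw_mode _ _ _); ring.
set m : rat := - 1 - (j + e)%:R + p%:R / T%:R.
have m_neq0 : m != 0.
  rewrite lt_eqF // /m; have : p%:R / T%:R < 1 :> rat.
    by rewrite ltr_pdivrMr ?ltr0n // mul1r ltr_nat.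
  by have : 0 <= (j + e)%:R :> rat by []; lra.
have -> : fmode u (j + e.+1) p w
    = - (ratr m)^-1 *: fmode (va_mode u (-2) (va_vac V)) (j + e) p w.
  rewrite /apply_factor (mode_derivative _ gu) ?fmode_exponent //.
  rewrite -/m scalerA mulrNN mulVf ?fmorph_eq0 // scale1r.
  by rewrite addnS -natr1 /m; congr (tw_mode _ _ _); ring.
apply: submoduleZ; first exact: C_submodule.
by apply: IHe; exact: grade_derivative.
Qed.

(* The subtraction of the carry is never truncated, here and below. *)
Lemma fmode_commutator (r s : 'I_T) u v k j w :
  grade g T r u -> grade g T s v ->
  exists (M : nat) (c : nat -> R[i]),
    fmode u k r (fmode v j s w) = fmode v j s (fmode u k r w)
    + \sum_(i < M) c i *:
        fmode (va_mode u i v) (k + j + 1 + i - carry r s) (sum_degree r s) w.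
Proof.
move=> gu gv.
have [M0 /(_ M0.+1 (leqnSn _)) bor] :=
  borcherds_identity 0 (- 1 - j%:R + s%:R / T%:R) w gu gv (fmode_exponent k r).
exists M0.+1, (fun i => ratr (gbinom (- 1 - k%:R + r%:R / T%:R) i)).
have -> : \sum_(i < M0.+1) ratr (gbinom (- 1 - k%:R + r%:R / T%:R) i) *:
      fmode (va_mode u i v) (k + j + 1 + i - carry r s) (sum_degree r s) w
    = fmode u k r (fmode v j s w) - fmode v j s (fmode u k r w).
  transitivity (\sum_(i < M0.+1) ratr (gbinom (- 1 - k%:R + r%:R / T%:R) i) *:
      mode (va_mode u (0 + i%:Z) v)
        (- 1 - k%:R + r%:R / T%:R + (- 1 - j%:R + s%:R / T%:R) - i%:R) w).
    apply: eq_bigr => i _; congr (_ *: _); rewrite /apply_factor add0r.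
    congr (tw_mode _ _ _); have := sum_degree_exponent r s.
    rewrite natrB ?natrD; first by lra.
    by rewrite /carry; case: (T <= _)%N; lia.
  (* For l = 0, [gbinom 0 i] kills all terms on the right but the first of each sum, which give the
     commutator. *)
  rewrite bor !big_ord_recl !big1 => [|i _|i _].
  - by rewrite gbinom0 expr0 expr0z !mul1r rmorph1 !scale1r !addr0 ?subr0.
  - by rewrite [gbinom _ _]gbinom0n // mulr0 rmorph0 scale0r.
  - by rewrite [gbinom _ _]gbinom0n // mulr0 rmorph0 scale0r.
by rewrite addrC subrK.
Qed.

(** Commute u(k, r) past a generator v(j, s) w: the swapped product starts with v(j, s), and the
    corrections have depth at least k + j + i >= j. *)
Lemma C_stable j (r : 'I_T) u k x : grade g T r u ->
  C_space W j.+1 x -> C_space W j.+1 (fmode u k r x).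
Proof.
move=> gu; suff: C_space W j.+1 `<=` fmode u k r @^-1` C_space W j.+1 by exact.
apply: lspan_min.
  by apply: submodule_preimage; [exact: fmode_linear|exact: C_submodule].
move=> _ [s [v [w [gv ->]]]].
have -> : tw_mode v (- j.+1%:R + s%:R / T%:R) w = fmode v j s w.
  by rewrite /apply_factor -natr1; congr (tw_mode _ _ _); ring.
suff: C_space W j.+1 (fmode u k r (fmode v j s w)) by [].
have [M [c ->]] := fmode_commutator k j w gu gv.
apply: submoduleD; [exact: C_submodule|exact: C_fmode|].
apply: submodule_sum => [|i _]; first exact: C_submodule.
apply: submoduleZ; first exact: C_submodule.
apply: C_fmode; first exact: grade_mode.
by have := carry_le1 r s; lia.
Qed.

(* The l = -1 case of the Borcherds identity, normalized so that the product on
   the left is one of its terms; every term not shown is in C_(j + 2). *)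
Lemma fmode_product (r s : 'I_T) u v j w :
  grade g T r u -> grade g T s v -> (0 < j)%N ->
  C_space W j.+2 (fmode u j r (fmode v j s w)
    - fmode (va_mode u (-1) v) (2 * j - carry r s) (sum_degree r s) w).
Proof.
move=> gu gv j0.
have C0 := C_submodule j.+2.
(* With these values and l = -1, the [i]-th term of the first sum on the right is u(i, r) v(2j - i,
   s) w, so the wanted product is the term i = j. *)
pose m : rat := r%:R / T%:R; pose n : rat := - (2 * j)%:R - 1 + s%:R / T%:R.
have mr : m - r%:R / T%:R \is a Num.int by rewrite subrr.
have [M0 /(_ (M0 + j.+1)%N (leq_addr _ _))] :=
  borcherds_identity (-1) n w gu gv mr.
have jM : (j < M0 + j.+1)%N by lia.
have zM : (0 < M0 + j.+1)%N by lia.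
rewrite (bigD1 (Ordinal zM)) //= [X in _ = X - _](bigD1 (Ordinal jM)) //=.
set S1 := \sum_(i < _ | i != Ordinal zM) _.
set S2 := \sum_(i < _ | i != Ordinal jM) _.
set S3 := \sum_(i < _) _.
have CS1 : C_space W j.+2 S1.
  apply: submodule_sum => // i i0; apply: submoduleZ => //.
  have {}i0 : (0 < i)%N.
    by rewrite lt0n; apply: contraNneq i0 => i0; apply/eqP/val_inj.
  have -> : mode (va_mode u (- 1 + i%:Z) v) (m + n - i%:R) w =
      fmode (va_mode u (- 1 + i%:Z) v) (2 * j + i - carry r s)
        (sum_degree r s) w.
    rewrite /apply_factor; congr (tw_mode _ _ _).
    have := sum_degree_exponent r s; have := carry_le1 r s.
    by move=> ?; rewrite /m /n natrB ?natrD; [lra|lia].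
  apply: C_fmode; first exact: grade_mode.
  by have := carry_le1 r s; lia.
have CS2 : C_space W j.+2 S2.
  apply: submodule_sum => // i ij; apply: submoduleZ => //.
  have {}ij : (i : nat) != j by apply: contraNneq ij => ij; apply/eqP/val_inj.
  have -> x : mode u (m + (-1)%:~R - i%:R) x = fmode u i r x.
    by rewrite /apply_factor; congr (tw_mode _ _ _); rewrite /m; ring.
  (* For i > j the outer factor is deep enough; for i < j the inner one has depth 2j - i > j, and
     the outer one preserves [C_(j + 2)]. *)
  case: (ltnP j i) => [ji|ji]; first exact: C_fmode.
  apply: C_stable => //.
  have -> : mode v (n + i%:R) w = fmode v (2 * j - i) s w.
    rewrite /apply_factor; congr (tw_mode _ _ _).
    by rewrite /n natrB; [ring|lia].
  by apply: C_fmode => //; lia.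
have CS3 : C_space W j.+2 S3.
  apply: submodule_sum => // i _; apply: submoduleZ => //.
  have -> x : mode v (n + (-1)%:~R - i%:R) x = fmode v (2 * j + i + 1) s x.
    by rewrite /apply_factor; congr (tw_mode _ _ _); rewrite /n !natrD; ring.
  by apply: C_fmode => //; lia.
rewrite gbinom0 (gbinomN1 j) !rmorph1 !scale1r addr0.
have -> : mode u (m + (-1)%:~R - j%:R) (mode v (n + j%:R) w)
    = fmode u j r (fmode v j s w).
  rewrite /apply_factor; congr (tw_mode _ _ (tw_mode _ _ _));
    by rewrite /m /n ?natrM; ring.
have -> : mode (va_mode u (-1) v) (m + n - 0) w =
    fmode (va_mode u (-1) v) (2 * j - carry r s) (sum_degree r s) w.
  rewrite /apply_factor; congr (tw_mode _ _ _).
  have := sum_degree_exponent r s; have := carry_le1 r s.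
  by move=> ?; rewrite /m /n natrB ?natrD; [lra|lia].
set X := fmode u j r _; set Y := fmode _ _ _ w => XY.
suff: C_space W j.+2 (X - Y) by [].
have -> : X = Y + (S1 + S3 - S2) by rewrite !addrA XY subrK addrK.
rewrite [Y + _]addrC addrK.
by apply: submoduleB => //; exact: submoduleD.
Qed.

End TwistedModes.

(** * Products with many factors of positive depth *)

Section Products.
Variables (R : realType) (V : vertexAlgebra R) (g : V -> V) (T : nat).
Hypotheses (hg : va_automorphism g) (T_gt0 : (0 < T)%N).
Variable W : twistedModule g T.

Local Notation fmode u k p := (apply_factor W (u, (k%N : nat), p)).

Definition homogeneous (l : seq (Defs.factor V T)) : Prop :=
  forall f, f \in l -> grade g T f.2 f.1.1.

Definition deep (f : Defs.factor V T) : bool := (0 < f.1.2)%N.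

Lemma homogeneous_cons f l :
  homogeneous (f :: l) -> grade g T f.2 f.1.1 /\ homogeneous l.
Proof.
move=> hl; split=> [|h lh]; apply: hl; first exact: mem_head.
by rewrite inE lh orbT.
Qed.

Lemma homogeneous_cat l1 l2 :
  homogeneous (l1 ++ l2) -> homogeneous l1 /\ homogeneous l2.
Proof.
by move=> hl; split=> f fl; apply: hl; rewrite mem_cat fl ?orbT.
Qed.

Lemma C_stable_seq j l x : homogeneous l ->
  C_space W j.+1 x -> C_space W j.+1 (apply_factors W l x).
Proof.
elim: l => // -[[u k] r] l IHl /homogeneous_cons[/= gu hl] Cx /=.
exact/C_stable/IHl.
Qed.

(* Modulo C_3 only the operators u_(-2 + p/T) matter. Commuting them with
   u_(-1 + r/T) does not decrease T - p, and the product of two of them is one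
   of them with the values of T - p added, or vanishes if that sum exceeds T. *)
Definition C3_upto (c : nat) : set W :=
  lspan [set x | C_space W 3 x \/ exists (p : 'I_T) u w,
    [/\ grade g T p u, (c <= T - p)%N & x = fmode u 1 p w]].

Lemma C3_upto_fmode c c' (r : 'I_T) u k :
  (forall x, C_space W 3 x -> C3_upto c' (fmode u k r x)) ->
  (forall (p : 'I_T) v w, grade g T p v -> (c <= T - p)%N ->
     C3_upto c' (fmode u k r (fmode v 1 p w))) ->
  forall x, C3_upto c x -> C3_upto c' (fmode u k r x).
Proof.
move=> H1 H2; suff: C3_upto c `<=` fmode u k r @^-1` C3_upto c' by [].
apply: lspan_min.
  by apply: submodule_preimage; [exact: fmode_linear|exact: lspan_submodule].
by move=> x [/H1|[p [v [w [gv cp ->]]]]] //; exact: H2.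
Qed.

Lemma C3_upto_count l w : homogeneous l -> (0 < count deep l)%N ->
  C3_upto (count deep l) (apply_factors W l w).
Proof.
elim: l => // -[[u k] r] l IHl /homogeneous_cons[gu hl]; rewrite /= in gu.
have CC c x : C_space W 3 x -> C3_upto c x by move=> Cx; apply: sub_lspan; left.
have sub c := lspan_submodule _ : submodule (C3_upto c).
have gen c (p : 'I_T) v x : grade g T p v -> (c <= T - p)%N ->
    C3_upto c (fmode v 1 p x).
  by move=> gv cp; apply: sub_lspan; right; exists p, v, x.
rewrite -[count _ _]/((0 < k) + count deep l)%N.
rewrite -[apply_factors _ _ _]/(fmode u k r (apply_factors W l w)).
case: k => [|[|k]]; last first.
- by move=> _; apply/CC/C_fmode.
- rewrite add1n => _; have rT := ltn_ord r.
  case: (posnP (count deep l)) => [->|c0]; first by apply: gen => //; lia.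
  apply: (C3_upto_fmode (c := count deep l)) (IHl hl c0) => [x Cx|p v x gv cp].
    by apply: CC; exact: C_stable.
  have := @fmode_product _ _ _ _ hg T_gt0 W r p u v 1 x gu gv isT.
  set X := fmode u 1 r _; set Y := fmode _ _ _ x => XY.
  rewrite -[X](subrK Y); apply: submoduleD => //; first exact: CC.
  (* [Y] has depth 2 - d. If d = 0 it is in [C_3]; if d = 1, then T - q = (T - r) + (T - p), and T -
     r >= 1 accounts for the new factor. *)
  rewrite /Y; have := sum_degreeE r p; have pT := ltn_ord p.
  have gs := grade_mode hg (-1) gu gv.
  have := carry_le1 r p; case: (carry r p) => [|[|//]] _ rp.
    by apply: CC; exact: C_fmode.
  by apply: gen => //; move: rp; rewrite mul1n; lia.
- rewrite add0n => c0.
  apply: (C3_upto_fmode (c := count deep l)) (IHl hl c0) => [x Cx|p v x gv cp].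
    by apply: CC; exact: C_stable.
  have [M [c ->]] := fmode_commutator T_gt0 0%N 1%N x gu gv.
  apply: submoduleD => //; first exact: gen.
  apply: submodule_sum => // i _; apply: submoduleZ => //.
  have := sum_degreeE r p; have pT := ltn_ord p; have rT := ltn_ord r.
  have gs := grade_mode hg i gu gv.
  (* The corrections have depth 2 + i - d, so only d = 1 and i = 0 gives depth 1; then T - q >= T -
     p, so the bound survives. *)
  have := carry_le1 r p; case: (carry r p) => [|[|//]] _ rp.
    by apply: CC; apply: C_fmode => //; lia.
  case: (posnP i) => [i0|i0]; last by apply: CC; apply: C_fmode => //; lia.
  rewrite i0; apply: gen; first by rewrite -i0.
  by move: rp; rewrite mul1n; lia.
Qed.

(** As T - p <= T, a count above [T] rules out every generator of [C3_upto] outside [C_3]. *)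
Lemma C3_count l w : homogeneous l -> (T < count deep l)%N ->
  C_space W 3 (apply_factors W l w).
Proof.
move=> hl Tl; have := @C3_upto_count l w hl (leq_ltn_trans (leq0n _) Tl).
apply: lspan_min; first exact: C_submodule.
by move=> x [//|[p [u [y [_ cp _]]]]]; lia.
Qed.

Definition deep_span (c : nat) : set W :=
  lspan [set x | exists l w,
    [/\ homogeneous l, (c <= count deep l)%N & x = apply_factors W l w]].

Lemma deep_span_fmode c (r : 'I_T) u k x : grade g T r u ->
  deep_span c x -> deep_span ((0 < k) + c) (fmode u k r x).
Proof.
move=> gu.
suff: deep_span c `<=` fmode u k r @^-1` deep_span ((0 < k) + c) by exact.
apply: lspan_min.
  by apply: submodule_preimage; [exact: fmode_linear|exact: lspan_submodule].
move=> _ [l [w [hl cl ->]]]; apply: sub_lspan; exists ((u, k, r) :: l), w.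
split=> //; last by rewrite /= leq_add2l.
by move=> f; rewrite inE => /predU1P[->|/hl].
Qed.

(** This describes, modulo [C_(j + 2)], the result of moving an operator of depth [j] to the
    outermost place, past factors of which [c] are deep. *)
Definition C_deep (j c : nat) : set W :=
  lspan [set x | C_space W j.+2 x \/ exists (p : 'I_T) u y,
    [/\ grade g T p u, deep_span c y & x = fmode u j p y]].

Lemma C_deep_fmode j c (r : 'I_T) u k x : grade g T r u ->
  C_deep j c x -> C_deep j ((0 < k) + c) (fmode u k r x).
Proof.
move=> gu.
have CC c' y : C_space W j.+2 y -> C_deep j c' y.
  by move=> Cy; apply: sub_lspan; left.
have sub c' := lspan_submodule _ : submodule (C_deep j c').
suff: C_deep j c `<=` fmode u k r @^-1` C_deep j ((0 < k) + c) by exact.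
apply: lspan_min.
  by apply: submodule_preimage; [exact: fmode_linear|exact: lspan_submodule].
move=> {}x [Cx|[p [v [y [gv Dy ->]]]]]; first by apply: CC; exact: C_stable.
suff: C_deep j ((0 < k) + c) (fmode u k r (fmode v j p y)) by [].
have [M [d ->]] := fmode_commutator T_gt0 k j y gu gv.
apply: submoduleD => //.
  apply: sub_lspan; right; exists p, v, (fmode u k r y); split=> //.
  exact: deep_span_fmode.
apply: submodule_sum => // i _; apply: submoduleZ => //.
have gs := grade_mode hg i gu gv; have := carry_le1 r p.
(* A correction outside the first case has k = i = 0 and d = 1. It is again an operator of depth
   [j], and the factor absorbed into it was not deep, so the count is unaffected. *)
case: (leqP j.+1 (k + j + 1 + i - carry r p)) => [ji|ji] c1.
  by apply: CC; exact: C_fmode.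
have -> : (k + j + 1 + i - carry r p = j)%N by lia.
have -> : k = 0%N by lia.
by apply: sub_lspan; right; exists (sum_degree r p), (va_mode u i v), y.
Qed.

Lemma C_deep_count j l x : homogeneous l -> C_space W j.+1 x ->
  C_deep j (count deep l) (apply_factors W l x).
Proof.
move=> hl Cx; elim: l hl => [_|[[u k] r] l IHl /homogeneous_cons[/= gu hl]] /=.
  move: x Cx; apply: lspan_min; first exact: lspan_submodule.
  move=> _ [p [v [w [gv ->]]]]; apply: sub_lspan; right; exists p, v, w.
  split=> //; first by apply: sub_lspan; exists [::], w.
  by rewrite /apply_factor -natr1; congr (tw_mode _ _ _); ring.
exact/C_deep_fmode/IHl.
Qed.

Lemma split_count (I : Type) (a : pred I) (s : seq I) n : (n <= count a s)%N ->
  exists s1 s2, s = s1 ++ s2 /\ count a s1 = n.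
Proof.
elim: s n => [|x s IHs] n; first by rewrite leqn0 => /eqP->; exists [::], [::].
case: n => [|n] /=; first by exists [::], (x :: s).
case ax: (a x); rewrite ?add1n ?add0n => /IHs[s1 [s2 [-> <-]]];
  by exists (x :: s1), s2; rewrite /= ax.
Qed.

Lemma C_count_double j N : (1 < j)%N ->
  (forall l w, homogeneous l -> (N <= count deep l)%N ->
     C_space W j.+1 (apply_factors W l w)) ->
  forall l w, homogeneous l -> (N * 2 <= count deep l)%N ->
     C_space W j.+2 (apply_factors W l w).
Proof.
move=> j1 CN l w hl Nl.
have [l1 [l2 [lE l1N]]] : exists s1 s2, l = s1 ++ s2 /\ count deep s1 = N.
  by apply: split_count; lia.
move: hl Nl; rewrite lE count_cat l1N => /homogeneous_cat[hl1 hl2] Nl2.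
rewrite /apply_factors foldr_cat -/(apply_factors W _ _).
have Cl2 : C_space W j.+1 (apply_factors W l2 w) by apply: CN => //; lia.
have := C_deep_count hl1 Cl2; rewrite l1N.
apply: lspan_min; first exact: C_submodule.
move=> x [//|[p [u [y [gu Dy ->]]]]].
(* The hypothesis [CN] is used a second time, now for the [N] deep factors that remain inside the
   operator moved out. *)
have Cy : C_space W j.+1 y.
  move: y Dy; apply: lspan_min; first exact: C_submodule.
  by move=> _ [l' [w' [hl' Nl' ->]]]; exact: CN.
suff: C_space W j.+1 `<=` fmode u j p @^-1` C_space W j.+2 by exact.
apply: lspan_min.
  by apply: submodule_preimage; [exact: fmode_linear|exact: C_submodule].
move=> _ [s [v [z [gv ->]]]].
have -> : tw_mode v (- j.+1%:R + s%:R / T%:R) z = fmode v j s z.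
  by rewrite /apply_factor -natr1; congr (tw_mode _ _ _); ring.
have := @fmode_product _ _ _ _ hg T_gt0 W p s u v j z gu gv (ltnW j1).
set X := fmode u j p _; set Y := fmode _ _ _ z => XY.
suff: C_space W j.+2 X by [].
rewrite -[X](subrK Y); apply: submoduleD => //; first exact: C_submodule.
apply: C_fmode => //; first exact: grade_mode.
(* Here j > 1 matters: it gives 2j - d >= j + 1 even when d = 1. *)
by have := carry_le1 p s; lia.
Qed.

Lemma C_count n l w : homogeneous l -> (T.+1 * 2 ^ n <= count deep l)%N ->
  C_space W n.+3 (apply_factors W l w).
Proof.
elim: n l w => [|n IHn] l w hl; first by rewrite expn0 muln1; exact: C3_count.
by rewrite expnSr mulnA; apply: (C_count_double _ IHn).
Qed.

End Products.

(** * Comparison of the two filtrations *)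

Section Filtrations.
Variables (R : realType) (V : vertexAlgebra R) (g : V -> V) (T : nat).
Hypotheses (hg : va_automorphism g) (T_gt0 : (0 < T)%N).
Variable W : twistedModule g T.

Lemma E_space_decr (m n : int) : m <= n -> E_space W n `<=` E_space W m.
Proof.
move=> mn; apply: lspan_min; first exact: lspan_submodule.
move=> x [l [w [l0 hl nl ->]]]; apply: sub_lspan; exists l, w; split=> //.
by apply: le_trans nl; rewrite ler_pM2r ?invr_gt0 ?ltr0n // ler_int.
Qed.

Lemma C_sub_E n : (2 <= n)%N ->
  C_space W n `<=` E_space W ((n%:Z - 2) * T%:Z + 1).
Proof.
move=> n2; apply: lspan_min; first exact: lspan_submodule.
move=> _ [p [u [w [gu ->]]]]; apply: sub_lspan.
have n1 : n.-1%:R = n%:R - 1 :> rat by rewrite -subn1 natrB // ltnW.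
exists [:: (u, n.-1, p)], w; split=> //.
- by move=> f; rewrite inE => /eqP->.
- rewrite /factors_weight !big_seq1 /= ler_pdivrMr ?ltr0n //.
  rewrite [leRHS]mulrBl divfK ?(T_neq0 T_gt0) //.
  (* A single factor of depth n - 1 has weight n - 1 - p/T, and p + 1 <= T bounds this below by n -
     2 + 1/T. *)
  have : p.+1%:R <= T%:R :> rat by rewrite ler_nat.
  rewrite n1 -natr1 intrD intrM intrB; lra.
- rewrite /= /apply_factor; congr (tw_mode _ _ _).
  by rewrite n1; ring.
Qed.

Lemma sum_depth_le (l : seq (Defs.factor V T)) k :
  ~~ has (fun f => (k < f.1.2)%N) l ->
  (\sum_(f <- l) f.1.2 <= k * count (@deep _ V T) l)%N.
Proof.
elim: l => [|f l IHl] /=; first by rewrite big_nil.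
rewrite negb_or -leqNgt big_cons mulnDr => /andP[fk /IHl IH].
by apply: leq_add => //; rewrite /deep; case: posnP => [->|_]; rewrite ?muln1.
Qed.

Lemma E_sub_C n m : (2 <= n)%N ->
  Num.max 1 ((n%:R - 2) * T%:R * (T%:R + 1) * 2 ^ (n%:Z - 3)) <= m%:~R :> rat ->
  E_space W m `<=` C_space W n.
Proof.
case: n => [|[|n]] // _ hm; apply: lspan_min; first exact: C_submodule.
move=> _ [l [w [_ hl ml ->]]].
have [/hasP[f fl kf]|shallow] := boolP (has (fun f => (n < f.1.2)%N) l).
  case/splitPr: fl hl {ml} => l1 l2.
  move=> /homogeneous_cat[hl1 /homogeneous_cons[gf _]].
  rewrite /apply_factors foldr_cat; apply: C_stable_seq => //=.
  by case: f kf gf => -[u k] p /= kf gf; exact: C_fmode.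
(* The degrees only lower the weight, so [m / T] is at most the total depth, to which each deep
   factor now contributes at most [n]. *)
have sum_ge : m%:~R <= n%:R * (count (@deep _ V T) l)%:R * T%:R :> rat.
  rewrite -ler_pdivrMr ?ltr0n // -natrM; apply: le_trans ml _.
  apply: le_trans (_ : (\sum_(f <- l) f.1.2)%:R <= _); last first.
    by rewrite ler_nat; exact: sum_depth_le.
  rewrite /factors_weight natr_sum lerBlDr lerDl divr_ge0 //.
  by apply: sumr_ge0.
move: hm; rewrite ge_max => /andP[m1 hm].
(* For [C_2] no factor is deep, so m <= 0; this contradicts the 1 in the maximum, the other bound
   being 0 there. *)
case: n {shallow} => [|n] in hm sum_ge *; first
  by have := le_trans m1 sum_ge; rewrite !mul0r ler10.
apply: C_count => //; rewrite -(ler_nat rat).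
move: hm; rewrite (_ : n.+3%:Z - 3 = n%:Z); last by lia.
rewrite (_ : n.+3%:R - 2 = n.+1%:R :> rat); last by rewrite -!natr1; ring.
(* Cancelling n + 1 and [T] between the two bounds on [m] leaves (T + 1) 2^n <= count. *)
rewrite -exprnP => /le_trans/(_ sum_ge).
rewrite -!mulrA ler_pM2l ?ltr0n // [_ * T%:R]mulrC ler_pM2l ?ltr0n //.
by rewrite natrM natrX -[T.+1%:R]natr1.
Qed.

End Filtrations.

Theorem theorem5p7 (R : realType) (V : vertexAlgebra R) (g : V -> V) (T : nat)
    (hg : va_automorphism g) (hT : has_period g T) (W : twistedModule g T) :
  [/\ forall n : nat, (2 <= n)%N ->
        C_space W n `<=` E_space W ((n%:Z - 2) * T%:Z + 1),
      forall (n : nat) (m : int), (2 <= n)%N ->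
        Num.max 1 ((n%:R - 2) * T%:R * (T%:R + 1) * 2 ^ (n%:Z - 3))
          <= m%:~R :> rat ->
        E_space W m `<=` C_space W n
    & \bigcap_(n in [set n : int | 0 <= n]) E_space W n
      = \bigcap_(n in [set n : nat | (2 <= n)%N]) C_space W (n + 2)].
Proof.
have T_gt0 : (0 < T)%N by case: hT.
split=> [n|n m|]; [exact: C_sub_E|exact: E_sub_C|].
apply/seteqP; split=> x Hx n /= n0.
  (* Any [k] above the bound for [C_(n + 2)] works, since [x] lies in every [E_k] with k >= 0. *)
  have [k kP] := rat_arch
    (Num.max 1 (((n + 2)%:R - 2) * T%:R * (T%:R + 1) * 2 ^ ((n + 2)%:Z - 3))) 0.
  apply: (@E_sub_C _ _ _ _ hg T_gt0 _ _ k%:Z) (Hx k%:Z _) => //.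
    by rewrite addn2.
  by have := kP k (leqnn k); rewrite add0r.
(* Conversely, [C_(n + 4)] lies in [E_((n + 2) T + 1)], whose index is at least [n]. *)
case: n n0 => // n _.
apply: (@E_space_decr _ _ _ _ T_gt0 W) (C_sub_E T_gt0 _ (Hx (n + 2)%N _)).
- by nia.
- by rewrite addn2.
- by rewrite /= addn2.
Qed.
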